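(* Let $F$ be a field of characteristic $0$, let $R\in F[X]$ be a polynomial of degree $d\ge 0$, and let $W_1$, $H$, $G$, $\mathcal B_1^R$, $S$, $\sigma=e^{\mathrm{ad}_G}$, $\mathcal R_2$ and $b$ be as in the context. Put $L=\sigma(H)$ and $b'=b\circ\sigma^{-1}:\mathcal B_1^R\to \mathcal R_2$. Then $$b'(G)=\hat n\,R(\hat n-1)\,T^{-1},$$ $$b'(Y)=T+\sum_{j=1}^{d+1}\frac{(-1)^j\,\bigl[\hat n R(\hat n-1)T^{-1}\bigr]^{j-1}\,\bigl[(\Delta^jS)(\hat n)\bigr]}{j!},$$ $$b'(L)=\hat n .$$
   Context: $W_1$ is the first Weyl algebra over $F$: the unital associative algebra generated by $Y,Z$ with the relation $ZY-YZ=1$. Put $H=YZ$ and $G=R(H)Z\in W_1$, and let $\mathcal B_1^R\subset W_1$ be the subalgebra generated by $Y,H,G$. For a polynomial $f$, $\Delta f(X)=f(X+1)-f(X)$; $S(X):=R(X-1)X$. For an element $A$, $\mathrm{ad}_A(B)=AB-BA$. The automorphism $\sigma=e^{\mathrm{ad}_G}$ of $\mathcal B_1^R$ is $\sigma(A)=\sum_{j\ge0}\mathrm{ad}_G^j(A)/j!$ (a finite sum for each $A$, since $\mathrm{ad}_G$ is locally nilpotent on $\mathcal B_1^R$). $\mathcal R_2$ is the unital associative $F$-algebra generated by $T,T^{-1},\hat n$ with relations $TT^{-1}=T^{-1}T=1$, $[T,\hat n]=T$, $[T^{-1},\hat n]=-T^{-1}$. The map $b:\mathcal B_1^R\to\mathcal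 R_2$ is the anti-homomorphism (i.e. $F$-linear, unital, $b(m_1m_2)=b(m_2)b(m_1)$) with $b(Y)=T$, $b(H)=\hat n$, $b(G)=\hat nT^{-1}R(\hat n)$. (It is the restriction of the anti-homomorphism $W_1\to\mathcal R_2$ with $Y\mapsto T$, $Z\mapsto \hat nT^{-1}$.) *)

(* Defs.v *)
From HB Require Import structures.
From mathcomp Require Import all_boot all_order all_algebra.
From mathcomp Require Import boolp classical_sets functions cardinality fsbigop.
From mathcomp Require Import ring.

Set Implicit Arguments.
Unset Strict Implicit.
Unset Printing Implicit Defensive.
Import GRing.Theory.
Local Open Scope ring_scope.
Local Open Scope quotient_scope.

(* Unital associative F-algebras given by generators X and relations [rel]:
   expressions modulo the congruence generated by the F-algebra axioms
   and the relations. *)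

Inductive term (F X : Type) : Type :=
| Const of F
| Gen of X
| Add of term F X & term F X
| Mul of term F X & term F X.

Arguments Const {F X}.
Arguments Gen {F X}.

HB.instance Definition _ (F X : Type) := gen_eqMixin (term F X).
HB.instance Definition _ (F X : Type) := gen_choiceMixin (term F X).

Section Presentation.
Variables (F : fieldType) (X : Type).
Local Notation trm := (term F X).
Variable rel : trm -> trm -> Prop.

Inductive pres_eq : trm -> trm -> Prop :=
| pe_rel t u : rel t u -> pres_eq t u
| pe_refl t : pres_eq t t
| pe_sym t u : pres_eq t u -> pres_eq u t
| pe_trans t u v : pres_eq t u -> pres_eq u v -> pres_eq t v
| pe_add t t' u u' : pres_eq t t' -> pres_eq u u' ->
    pres_eq (Add t u) (Add t' u')
| pe_mul t t' u u' : pres_eq t t' -> pres_eq u u' ->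
    pres_eq (Mul t u) (Mul t' u')
| pe_addA t u v : pres_eq (Add t (Add u v)) (Add (Add t u) v)
| pe_addC t u : pres_eq (Add t u) (Add u t)
| pe_add0 t : pres_eq (Add (Const 0) t) t
| pe_addN t : pres_eq (Add (Mul (Const (-1)) t) t) (Const 0)
| pe_mulA t u v : pres_eq (Mul t (Mul u v)) (Mul (Mul t u) v)
| pe_mul1l t : pres_eq (Mul (Const 1) t) t
| pe_mulDl t u v : pres_eq (Mul (Add t u) v) (Add (Mul t v) (Mul u v))
| pe_mulDr t u v : pres_eq (Mul t (Add u v)) (Add (Mul t u) (Mul t v))
| pe_constD a b : pres_eq (Const (a + b)) (Add (Const a) (Const b))
| pe_constM a b : pres_eq (Const (a * b)) (Mul (Const a) (Const b))
| pe_constC a t : pres_eq (Mul (Const a) t) (Mul t (Const a)).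

Let peb (t u : trm) := `[< pres_eq t u >].

Fact peb_refl : reflexive peb.
Proof. by move=> t; apply/asboolP/pe_refl. Qed.

Fact peb_sym : symmetric peb.
Proof. by move=> t u; apply/asboolP/asboolP => /pe_sym. Qed.

Fact peb_trans : transitive peb.
Proof.
move=> u t v /asboolP tu /asboolP uv; apply/asboolP; exact: pe_trans tu uv.
Qed.

Definition pres_equiv : equiv_rel trm := EquivRel peb peb_refl peb_sym peb_trans.

Definition presented := {eq_quot pres_equiv}.
HB.instance Definition _ := Choice.on presented.

Definition cls (t : trm) : presented := \pi_presented t.

Lemma clsP t u : pres_eq t u <-> cls t = cls u.
Proof.
split=> [tu|/eqquotP/asboolP//].
by apply/eqquotP/asboolP.
Qed.

Lemma reprP x : cls (repr x) = x. Proof. exact: reprK. Qed.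

Lemma repr_eq t : pres_eq (repr (cls t)) t.
Proof. by apply/clsP; rewrite reprP. Qed.

Definition padd (x y : presented) := cls (Add (repr x) (repr y)).
Definition pmul (x y : presented) := cls (Mul (repr x) (repr y)).
Definition popp (x : presented) := cls (Mul (Const (-1)) (repr x)).
Definition pscale (a : F) (x : presented) := cls (Mul (Const a) (repr x)).

Lemma padd_cls t u : padd (cls t) (cls u) = cls (Add t u).
Proof. by apply/clsP; apply: pe_add; apply: repr_eq. Qed.

Lemma pmul_cls t u : pmul (cls t) (cls u) = cls (Mul t u).
Proof. by apply/clsP; apply: pe_mul; apply: repr_eq. Qed.

Lemma popp_cls t : popp (cls t) = cls (Mul (Const (-1)) t).
Proof. by apply/clsP; apply: pe_mul; [exact: pe_refl|exact: repr_eq]. Qed.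

Lemma pscale_cls a t : pscale a (cls t) = cls (Mul (Const a) t).
Proof. by apply/clsP; apply: pe_mul; [exact: pe_refl|exact: repr_eq]. Qed.

Lemma cls_ind (P : presented -> Prop) : (forall t, P (cls t)) -> forall x, P x.
Proof. by move=> Pt x; rewrite -(reprP x). Qed.

Fact paddA : associative padd.
Proof.
elim/cls_ind=> t; elim/cls_ind=> u; elim/cls_ind=> v; rewrite !padd_cls.
exact/clsP/pe_addA.
Qed.

Fact paddC : commutative padd.
Proof. elim/cls_ind=> t; elim/cls_ind=> u; rewrite !padd_cls; exact/clsP/pe_addC. Qed.

Fact padd0 : left_id (cls (Const 0)) padd.
Proof. elim/cls_ind=> t; rewrite padd_cls; exact/clsP/pe_add0. Qed.

Fact paddN : left_inverse (cls (Const 0)) popp padd.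
Proof. elim/cls_ind=> t; rewrite popp_cls padd_cls; exact/clsP/pe_addN. Qed.

HB.instance Definition _ :=
  GRing.isZmodule.Build presented paddA paddC padd0 paddN.

Lemma clsD t u : cls t + cls u = cls (Add t u). Proof. exact: padd_cls. Qed.

Lemma clsN t : - cls t = cls (Mul (Const (-1)) t). Proof. exact: popp_cls. Qed.

Fact pmulA : associative pmul.
Proof.
elim/cls_ind=> t; elim/cls_ind=> u; elim/cls_ind=> v; rewrite !pmul_cls.
exact/clsP/pe_mulA.
Qed.

Fact pmul1l : left_id (cls (Const 1)) pmul.
Proof. elim/cls_ind=> t; rewrite pmul_cls; exact/clsP/pe_mul1l. Qed.

Fact pmul1r : right_id (cls (Const 1)) pmul.
Proof.
elim/cls_ind=> t; rewrite pmul_cls.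
by apply/clsP; apply: pe_trans (pe_mul1l _); apply/pe_sym/pe_constC.
Qed.

Fact pmulDl : left_distributive pmul +%R.
Proof.
elim/cls_ind=> t; elim/cls_ind=> u; elim/cls_ind=> v.
rewrite clsD !pmul_cls clsD; exact/clsP/pe_mulDl.
Qed.

Fact pmulDr : right_distributive pmul +%R.
Proof.
elim/cls_ind=> t; elim/cls_ind=> u; elim/cls_ind=> v.
rewrite clsD !pmul_cls clsD; exact/clsP/pe_mulDr.
Qed.

HB.instance Definition _ :=
  GRing.Zmodule_isPzRing.Build presented pmulA pmul1l pmul1r pmulDl pmulDr.

Lemma clsM t u : cls t * cls u = cls (Mul t u). Proof. exact: pmul_cls. Qed.

Lemma pscaleE a (x : presented) : pscale a x = cls (Const a) * x.
Proof. by elim/cls_ind: x => t; rewrite pscale_cls [RHS]clsM. Qed.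

Lemma cls_constD a b : cls (Const (a + b)) = cls (Const a) + cls (Const b).
Proof. rewrite [RHS]clsD; exact/clsP/pe_constD. Qed.

Lemma cls_constM a b : cls (Const (a * b)) = cls (Const a) * cls (Const b).
Proof. rewrite [RHS]clsM; exact/clsP/pe_constM. Qed.

Lemma cls_constC a (x : presented) : cls (Const a) * x = x * cls (Const a).
Proof.
elim/cls_ind: x => t; rewrite [LHS]clsM [RHS]clsM; exact/clsP/pe_constC.
Qed.

Fact pscaleA a b v : pscale a (pscale b v) = pscale (a * b) v.
Proof. by rewrite !pscaleE cls_constM mulrA. Qed.

Fact pscale1 : left_id 1 pscale.
Proof. by move=> v; rewrite pscaleE mul1r. Qed.

Fact pscaleDr : right_distributive pscale +%R.
Proof. by move=> a u v; rewrite !pscaleE mulrDr. Qed.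

Fact pscaleDl v : {morph pscale^~ v : a b / a + b}.
Proof. by move=> a b; rewrite !pscaleE cls_constD mulrDl. Qed.

HB.instance Definition _ :=
  GRing.Zmodule_isLmodule.Build F presented pscaleA pscale1 pscaleDr pscaleDl.

Lemma presZE a (x : presented) : a *: x = cls (Const a) * x.
Proof. exact: pscaleE. Qed.

Lemma presZAl a (x y : presented) : a *: (x * y) = (a *: x) * y.
Proof. by rewrite !presZE mulrA. Qed.

Lemma presZAr a (x y : presented) : a *: (x * y) = x * (a *: y).
Proof. by rewrite !presZE mulrA cls_constC -mulrA. Qed.

(* [algType] structures are nontrivial by definition; a representation on a
   nonzero module shows that a presented algebra is nontrivial. *)

Section Representation.
Variables (M : lmodType F) (rho : X -> M -> M).

Fixpoint act (t : trm) (m : M) : M :=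
  match t with
  | Const a => a *: m
  | Gen x => rho x m
  | Add t u => act t m + act u m
  | Mul t u => act t (act u m)
  end.

Lemma presented_nontrivial (m : M) :
  m != 0 -> (forall x, linear (rho x)) ->
  (forall t u, rel t u -> act t =1 act u) ->
  (1 : presented) != 0.
Proof.
move=> m0 lin_rho rel_act.
have lin_act t : linear (act t).
  elim: t => [a|x|t IHt u IHu|t IHt u IHu] b v w /=.
  - by rewrite scalerDr !scalerA mulrC.
  - exact: lin_rho.
  - by rewrite IHt IHu scalerDr addrACA.
  - by rewrite IHu IHt.
have act_eq t u : pres_eq t u -> act t =1 act u.
  elim=> {t u} //=.
  - by move=> t u _ IH v; rewrite IH.
  - by move=> t u w _ IH1 _ IH2 v; rewrite IH1 IH2.
  - by move=> t t' u u' _ IH1 _ IH2 v; rewrite IH1 IH2.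
  - by move=> t t' u u' _ IH1 _ IH2 v; rewrite IH2 IH1.
  - by move=> t u w v; rewrite addrA.
  - by move=> t u v; rewrite addrC.
  - by move=> t v; rewrite scale0r add0r.
  - by move=> t v; rewrite scaleN1r addNr scale0r.
  - by move=> t v; rewrite scale1r.
  - move=> t u w v; rewrite -[act u v]scale1r lin_act; by rewrite !scale1r.
  - by move=> a b v; rewrite scalerDl.
  - by move=> a b v; rewrite scalerA.
  - move=> a t v.
    have t0 : act t 0 = 0.
      by have := lin_act t (-1) 0 0; rewrite scaler0 addr0 scaleN1r addNr.
    by have := lin_act t a v 0; rewrite t0 !addr0 => ->.
apply/eqP => /clsP /act_eq /(_ m) /=.
by rewrite scale1r scale0r; apply/eqP.
Qed.

End Representation.

Section AntiLift.
Variables (A : algType F) (f : X -> A).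

Fixpoint anti_eval (t : trm) : A :=
  match t with
  | Const a => a%:A
  | Gen x => f x
  | Add t u => anti_eval t + anti_eval u
  | Mul t u => anti_eval u * anti_eval t
  end.

Definition anti_lift (x : presented) : A := anti_eval (repr x).

Hypothesis rel_f : forall t u, rel t u -> anti_eval t = anti_eval u.

Lemma anti_liftE t : anti_lift (cls t) = anti_eval t.
Proof.
suff eval_eq u v : pres_eq u v -> anti_eval u = anti_eval v.
  exact/eval_eq/repr_eq.
elim=> {t u v} //=.
- by move=> t u w _ IH1 _ IH2; rewrite IH1 IH2.
- by move=> t t' u u' _ IH1 _ IH2; rewrite IH1 IH2.
- by move=> t t' u u' _ IH1 _ IH2; rewrite IH1 IH2.
- by move=> t u w; rewrite addrA.
- by move=> t u; rewrite addrC.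
- by move=> t; rewrite scale0r add0r.
- by move=> t; rewrite scaleN1r mulrN1 addNr scale0r.
- by move=> t u w; rewrite mulrA.
- by move=> t; rewrite scale1r mulr1.
- by move=> t u w; rewrite mulrDr.
- by move=> t u w; rewrite mulrDl.
- by move=> a b; rewrite scalerDl.
- by move=> a b; rewrite mulr_algl scalerA mulrC.
- by move=> a t; rewrite mulr_algl mulr_algr.
Qed.

Lemma anti_lift_linear : linear anti_lift.
Proof.
move=> a; elim/cls_ind=> t; elim/cls_ind=> u.
have -> : a *: cls t + cls u = cls (Add (Mul (Const a) t) u).
  by rewrite presZE [_ * _]clsM [LHS]clsD.
by rewrite !anti_liftE /= mulr_algr.
Qed.

Lemma anti_lift1 : anti_lift 1 = 1.
Proof. by rewrite anti_liftE /= scale1r. Qed.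

Lemma anti_liftM x y : anti_lift (x * y) = anti_lift y * anti_lift x.
Proof.
by elim/cls_ind: x => t; elim/cls_ind: y => u; rewrite [_ * _]clsM !anti_liftE.
Qed.

End AntiLift.

End Presentation.

Variant weyl_gen := gY | gZ.

Variant weyl_rel (F : fieldType) : term F weyl_gen -> term F weyl_gen -> Prop :=
| WeylZY : weyl_rel
    (Add (Mul (Gen gZ) (Gen gY)) (Mul (Const (-1)) (Mul (Gen gY) (Gen gZ))))
    (Const 1).

Definition weyl (F : fieldType) := presented (@weyl_rel F).

Section Weyl.
Variable F : fieldType.

HB.instance Definition _ := GRing.PzRing.on (weyl F).
HB.instance Definition _ := GRing.Lmodule.on (weyl F).

Fact weyl_nontrivial : (1 : weyl F) != 0.
Proof.
apply: (@presented_nontrivial _ _ _ {poly F}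
  (fun x => if x is gY then fun p => 'X * p else fun p => p^`()) 1).
- exact: oner_neq0.
- case=> a p q.
    by rewrite mulrDr scalerAr.
  by rewrite derivD derivZ.
- move=> t u [] p /=; rewrite derivM derivX scaleN1r scale1r mul1r.
  by rewrite addrK.
Qed.

HB.instance Definition _ :=
  GRing.PzSemiRing_isNonZero.Build (weyl F) weyl_nontrivial.
HB.instance Definition _ :=
  GRing.Lmodule_isLalgebra.Build F (weyl F) (@presZAl _ _ _).
HB.instance Definition _ :=
  GRing.Lalgebra_isAlgebra.Build F (weyl F) (@presZAr _ _ _).

Definition wY : weyl F := cls _ (Gen gY).
Definition wZ : weyl F := cls _ (Gen gZ).
Definition wH : weyl F := wY * wZ.

Lemma weyl_relE : wZ * wY - wY * wZ = 1.
Proof.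
have -> : wZ * wY - wY * wZ = cls _ (Add (Mul (Gen gZ) (Gen gY))
    (Mul (Const (-1)) (Mul (Gen gY) (Gen gZ)))).
  rewrite [_ * _]clsM; rewrite [wY * wZ]clsM [- _]clsN; exact: clsD.
exact/clsP/pe_rel/WeylZY.
Qed.

End Weyl.

Arguments wY {F}.
Arguments wZ {F}.
Arguments wH {F}.

Variant r2_gen := gT | gTinv | gN.

Variant r2_rel (F : fieldType) : term F r2_gen -> term F r2_gen -> Prop :=
| R2_TTinv : r2_rel (Mul (Gen gT) (Gen gTinv)) (Const 1)
| R2_TinvT : r2_rel (Mul (Gen gTinv) (Gen gT)) (Const 1)
| R2_Tn : r2_rel
    (Add (Mul (Gen gT) (Gen gN)) (Mul (Const (-1)) (Mul (Gen gN) (Gen gT))))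
    (Gen gT)
| R2_Tinvn : r2_rel
    (Add (Mul (Gen gTinv) (Gen gN))
         (Mul (Const (-1)) (Mul (Gen gN) (Gen gTinv))))
    (Mul (Const (-1)) (Gen gTinv)).

Definition R2 (F : fieldType) := presented (@r2_rel F).

Section R2.
Variable F : fieldType.

HB.instance Definition _ := GRing.PzRing.on (R2 F).
HB.instance Definition _ := GRing.Lmodule.on (R2 F).

Fact R2_nontrivial : (1 : R2 F) != 0.
Proof.
apply: (@presented_nontrivial _ _ _ {poly F}
  (fun x => match x with
            | gT => fun p => p \Po ('X + 1)
            | gTinv => fun p => p \Po ('X - 1)
            | gN => fun p => 'X * p
            end) 1).
- exact: oner_neq0.
- case=> a p q.
  + by rewrite comp_polyD comp_polyZ.
  + by rewrite comp_polyD comp_polyZ.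
  + by rewrite mulrDr scalerAr.
- move=> t u [] p /=; rewrite ?scaleN1r ?scale1r.
  + rewrite -comp_polyA comp_polyB comp_polyX -polyC1 comp_polyC.
    by rewrite addrK comp_polyXr.
  + rewrite -comp_polyA comp_polyD comp_polyX -polyC1 comp_polyC.
    by rewrite subrK comp_polyXr.
  + by rewrite comp_polyM comp_polyX mulrDl mul1r addrC addKr.
  + by rewrite comp_polyM comp_polyX mulrBl mul1r addrAC subrr add0r.
Qed.

HB.instance Definition _ :=
  GRing.PzSemiRing_isNonZero.Build (R2 F) R2_nontrivial.
HB.instance Definition _ :=
  GRing.Lmodule_isLalgebra.Build F (R2 F) (@presZAl _ _ _).
HB.instance Definition _ :=
  GRing.Lalgebra_isAlgebra.Build F (R2 F) (@presZAr _ _ _).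

Definition rT : R2 F := cls _ (Gen gT).
Definition rTinv : R2 F := cls _ (Gen gTinv).
Definition rn : R2 F := cls _ (Gen gN).

Lemma R2_relE : [/\ rT * rTinv = 1, rTinv * rT = 1,
  rT * rn - rn * rT = rT & rTinv * rn - rn * rTinv = - rTinv].
Proof.
have clsB t u : cls (@r2_rel F) t - cls _ u =
    cls _ (Add t (Mul (Const (-1)) u)).
  by rewrite [- _]clsN; exact: clsD.
split.
- rewrite [LHS]clsM; exact/clsP/pe_rel/R2_TTinv.
- rewrite [LHS]clsM; exact/clsP/pe_rel/R2_TinvT.
- rewrite [rT * _]clsM [rn * _]clsM clsB; exact/clsP/pe_rel/R2_Tn.
- rewrite [rTinv * _]clsM [rn * _]clsM clsB [RHS]clsN.
  exact/clsP/pe_rel/R2_Tinvn.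
Qed.

End R2.

Arguments rT {F}.
Arguments rTinv {F}.
Arguments rn {F}.

Section GeneratedSubalgebra.
Variables (F : fieldType) (A : algType F) (E : set A).

Definition gen_subalg : {pred A} := fun x =>
  `[< forall S : {pred A}, subalg_closed S ->
        (forall e, E e -> e \in S) -> x \in S >].

Lemma gen_subalgP x :
  reflect (forall S : {pred A}, subalg_closed S ->
             (forall e, E e -> e \in S) -> x \in S) (x \in gen_subalg).
Proof. exact: asboolP. Qed.

Lemma gen_subalg_gen e : E e -> e \in gen_subalg.
Proof. by move=> Ee; apply/gen_subalgP => S _; apply. Qed.

Fact gen_subalg_closed : subalg_closed gen_subalg.
Proof.
split.
- by apply/gen_subalgP => S [].
- move=> a u v /gen_subalgP Su /gen_subalgP Sv; apply/gen_subalgP => S SS ES.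
  have [_ lin _] := SS; exact: lin (Su S SS ES) (Sv S SS ES).
- move=> u v /gen_subalgP Su /gen_subalgP Sv; apply/gen_subalgP => S SS ES.
  have [_ _ mul] := SS; exact: mul (Su S SS ES) (Sv S SS ES).
Qed.

HB.instance Definition _ := GRing.isSubalgClosed.Build F A gen_subalg
  (GRing.subalg_closed_semi gen_subalg_closed).

End GeneratedSubalgebra.

Record subalg_of (F : fieldType) (A : algType F) (E : set A) :=
  SubalgOf { subalg_val : A; _ : subalg_val \in gen_subalg E }.

Section SubalgebraType.
Variables (F : fieldType) (A : algType F) (E : set A).
HB.instance Definition _ := [isSub for @subalg_val F A E].
HB.instance Definition _ := [Choice of subalg_of E by <:].
HB.instance Definition _ := [SubChoice_isSubAlgebra of subalg_of E by <:].
End SubalgebraType.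

(* ad and its exponential; the sum over all j is the library's finitely
   supported sum, which has its usual meaning at x as soon as ad_a is nilpotent
   at x (see [exp_adE]) and is 0 by convention otherwise. *)

Section AdExp.
Variables (F : fieldType) (A : algType F).
Implicit Types a x y : A.

Definition ad a x := a * x - x * a.

Definition exp_ad a x : A :=
  \sum_(j \in [set: nat]) (j`!%:R^-1 : F) *: iter j (ad a) x.

Definition ad_nilp a x := exists n, iter n (ad a) x = 0.

Lemma ad_linear a : linear (ad a).
Proof.
move=> k x y; rewrite /ad mulrDr mulrDl -scalerAr -scalerAl scalerBr opprD.
by rewrite addrACA.
Qed.

HB.instance Definition _ a := GRing.isLinear.Build F A A _ (ad a) (ad_linear a).

Lemma iter_ad_linear a n : linear (iter n (ad a)).
Proof. by elim: n => [|n IH] k x y //=; rewrite (IH k x y) linearP. Qed.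

HB.instance Definition _ a n :=
  GRing.isLinear.Build F A A _ (iter n (ad a)) (iter_ad_linear a n).

Lemma ad_derivation a x y : ad a (x * y) = ad a x * y + x * ad a y.
Proof. by rewrite /ad mulrBl mulrBr !mulrA addrA subrK. Qed.

Lemma iter_ad_ge a x n m : (n <= m)%N ->
  iter n (ad a) x = 0 -> iter m (ad a) x = 0.
Proof. by move=> /subnK <- x0; rewrite iterD x0 linear0. Qed.

Lemma exp_adE a x n : iter n (ad a) x = 0 ->
  exp_ad a x = \sum_(j < n) (j`!%:R^-1 : F) *: iter j (ad a) x.
Proof.
move=> x0; rewrite /exp_ad -(fsbig_widen (`I_n)%classic) //.
  by rewrite -fsbig_ord.
move=> j /= [_] /negP; rewrite -leqNgt => nj.
by rewrite (iter_ad_ge nj x0) scaler0.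
Qed.

Lemma iter_ad_mul a x y k n m : (n + m <= k)%N ->
  iter n (ad a) x = 0 -> iter m (ad a) y = 0 -> iter k (ad a) (x * y) = 0.
Proof.
elim: k n m x y => [|k IH] n m x y nmk x0 y0.
  move: nmk x0; rewrite leqn0 addn_eq0 => /andP[/eqP-> _] /= ->.
  by rewrite mul0r.
case: n nmk x0 => [|n] nmk x0; first by rewrite [x]x0 mul0r linear0.
case: m nmk y0 => [|m] nmk y0; first by rewrite [y]y0 mulr0 linear0.
rewrite iterSr ad_derivation linearD /=.
rewrite (IH n m.+1) -?iterSr // ?(IH n.+1 m) -?iterSr // ?addr0 //.
by move: nmk; rewrite addnS.
Qed.

Lemma ad_nilp_closed a : subalg_closed (fun x => `[< ad_nilp a x >]).
Proof.
split.
- by apply/asboolP; exists 1%N; rewrite /= /ad mulr1 mul1r subrr.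
- move=> k x y /asboolP[n x0] /asboolP[m y0]; apply/asboolP.
  exists (n + m)%N; rewrite linearP /=.
  rewrite (iter_ad_ge (leq_addr m n) x0) (iter_ad_ge (leq_addl n m) y0).
  by rewrite scaler0 addr0.
- move=> x y /asboolP[n x0] /asboolP[m y0]; apply/asboolP.
  by exists (n + m)%N; apply: iter_ad_mul x0 y0.
Qed.

Lemma adN a x : ad (- a) x = - ad a x.
Proof. by rewrite /ad mulNr mulrN opprK opprB addrC. Qed.

Lemma iter_adN a x n : iter n (ad (- a)) x = (-1) ^+ n *: iter n (ad a) x.
Proof.
elim: n => [|n IH]; first by rewrite scale1r.
by rewrite !iterS IH adN linearZ /= exprS mulN1r scaleNr.
Qed.

Lemma exp_coef_inv k : [pchar F] =i pred0 ->
  \sum_(0 <= i < k.+1) (i`!%:R^-1 * (-1) ^+ i * (k - i)`!%:R^-1 : F) =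
  (k == 0)%:R.
Proof.
move=> F0; have fact0 n : (n`!%:R : F) != 0.
  by move/pcharf0P: F0 => ->; rewrite -lt0n fact_gt0.
apply: (mulfI (fact0 k)); rewrite mulr_sumr big_mkord.
transitivity ((1 + -1) ^+ k : F); last first.
  by rewrite subrr expr0n; case: k => [|k]; rewrite /= ?mulr1 ?mulr0.
rewrite exprDn; apply: eq_bigr => i _; rewrite expr1n mul1r -mulr_natr.
have ik : (i <= k)%N by rewrite -ltnS.
rewrite -(bin_fact ik) !natrM; field.
by rewrite !fact0.
Qed.

Lemma exp_adNK a x : [pchar F] =i pred0 -> ad_nilp a x ->
  exp_ad (- a) (exp_ad a x) = x.
Proof.
move=> F0 [n x0].
have y0 : iter n (ad (- a)) (exp_ad a x) = 0.
  rewrite iter_adN (exp_adE x0) linear_sum big1 ?scaler0 // => j _.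
  by rewrite linearZ /= -(iterD n j (ad a)) addnC iterD x0 linear0 scaler0.
rewrite (exp_adE y0) (exp_adE x0).
pose c i k : F := i`!%:R^-1 * (-1) ^+ i * (k - i)`!%:R^-1.
transitivity (\sum_(0 <= i < n) \sum_(0 <= k < n | (i <= k)%N)
    c i k *: iter k (ad a) x).
  rewrite big_mkord; apply: eq_bigr => i _.
  rewrite iter_adN linear_sum /= -(big_mkord xpredT
    (fun j => iter i (ad a) (j`!%:R^-1 *: iter j (ad a) x))) !scaler_sumr.
  transitivity (\sum_(0 + i <= k < n + i) c i k *: iter k (ad a) x).
    rewrite big_addn addnK; apply: eq_bigr => j _.
    rewrite [iter i _ _]linearZ /= -(iterD i j (ad a)) !scalerA addnC /c addnC.
    by rewrite addKn.
  rewrite add0n (@big_cat_nat _ _ _ n) ?leq_addr //=; last exact: ltnW.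
  rewrite [X in _ + X]big_nat_cond [X in _ + X]big1 ?addr0; last first.
    by move=> k /andP[/andP[nk _] _]; rewrite (iter_ad_ge nk x0) scaler0.
  by rewrite (big_nat_widenl _ 0).
rewrite (exchange_big_dep_nat xpredT) //=.
transitivity (\sum_(0 <= k < n) ((k == 0)%:R : F) *: iter k (ad a) x).
  apply: eq_big_nat => k /andP[_ kn]; rewrite -exp_coef_inv // scaler_suml.
  by rewrite [RHS](big_nat_widen _ _ n).
case: n x0 {y0} => [|n] x0; first by rewrite big_geq //; exact: esym.
rewrite big_nat_recl // scale1r big1 ?addr0 // => i _; by rewrite scale0r.
Qed.

Lemma exp_adKN a x : [pchar F] =i pred0 -> ad_nilp a x ->
  exp_ad a (exp_ad (- a) x) = x.
Proof.
move=> F0 [n x0]; rewrite -{1}[a]opprK exp_adNK //.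
by exists n; rewrite iter_adN x0 scaler0.
Qed.

Lemma exp_ad_bij a : [pchar F] =i pred0 -> (forall x, ad_nilp a x) ->
  bijective (exp_ad a).
Proof.
by move=> F0 nil; exists (exp_ad (- a)) => x; rewrite ?exp_adNK ?exp_adKN.
Qed.

End AdExp.

Definition Delta (F : fieldType) (f : {poly F}) : {poly F} :=
  f \Po ('X + 1) - f.

Lemma val_iter_ad (F : fieldType) (A : algType F) (E : set A)
    (a x : subalg_of E) n :
  val (iter n (ad a) x) = iter n (ad (val a)) (val x).
Proof.
elim: n => // n IH; rewrite !iterS -IH /ad; set y := iter n _ x.
by rewrite GRing.valB !GRing.valM.
Qed.

Section B1.
Variables (F : fieldType) (R : {poly F}).

(* S(X) = R(X-1) X *)
Definition Spoly : {poly F} := (R \Po ('X - 1)) * 'X.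

Definition wG : weyl F := horner_alg wH R * wZ.

Definition B1_gens : set (weyl F) := [set wY; wH; wG]%classic.

Definition B1 := subalg_of B1_gens.

Fact wY_in : wY \in gen_subalg B1_gens.
Proof. by apply: gen_subalg_gen; left; left. Qed.
Fact wH_in : wH \in gen_subalg B1_gens.
Proof. by apply: gen_subalg_gen; left; right. Qed.
Fact wG_in : wG \in gen_subalg B1_gens.
Proof. by apply: gen_subalg_gen; right. Qed.

Definition BY : B1 := SubalgOf wY_in.
Definition BH : B1 := SubalgOf wH_in.
Definition BG : B1 := SubalgOf wG_in.

Definition sigma : B1 -> B1 := exp_ad BG.

(* The inverse of sigma, as the library's total inverse of a function; it is a
   two-sided inverse by [sigmaK] and [sigma_invK]. *)
Definition sigma_inv : B1 -> B1 := 'pinv_id setT sigma.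

Lemma weyl_Y_horner p : wY * horner_alg wH p = horner_alg (wH - 1) p * wY :> weyl F.
Proof.
have YH : wY * wH = (wH - 1) * wY :> weyl F.
  rewrite mulrBl mul1r /wH -mulrA -[wZ * wY](subrK (wY * wZ)) weyl_relE.
  by rewrite mulrDr mulr1 addrAC subrr add0r.
elim/poly_ind: p => [|p c IH]; first by rewrite !rmorph0 mulr0 mul0r.
rewrite !rmorphD !rmorphM /= !horner_algX !horner_algC mulrDr mulrDl mulrA IH.
by rewrite -!mulrA YH mulr_algl mulr_algr.
Qed.

Lemma horner_alg_comm (A : algType F) (h : A) p :
  h * horner_alg h p = horner_alg h p * h.
Proof.
by have /(congr1 (horner_alg h)) := mulrC 'X p; rewrite !rmorphM /= horner_algX.
Qed.

Lemma horner_alg_mem (A : algType F) (S : {pred A}) h p :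
  subalg_closed S -> h \in S -> horner_alg h p \in S.
Proof.
move=> SS hS.
have [S1 lin mul] := SS.
have S0 : 0 \in S by rewrite -(subrr 1) -scaleN1r addrC lin.
elim/poly_ind: p => [|p c IH]; first by rewrite rmorph0.
rewrite rmorphD rmorphM /= horner_algX horner_algC addrC lin //.
exact: mul.
Qed.

Lemma wG_ad_nilp x : x \in gen_subalg B1_gens -> ad_nilp wG x.
Proof.
pose S : {pred weyl F} := fun x => `[< ad_nilp wG x >].
have SS : subalg_closed S by exact: ad_nilp_closed.
have [S1 lin mul] := SS.
have GS : wG \in S by apply/asboolP; exists 1%N; rewrite /= /ad subrr.
have adS y : ad wG y \in S -> y \in S.
  by move=> /asboolP[n y0]; apply/asboolP; exists n.+1; rewrite iterSr.
have ZH : wZ * wH = wH * wZ + wZ :> weyl F.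
  rewrite /wH mulrA -[wZ * wY](subrK (wY * wZ)) weyl_relE mulrDl mul1r.
  by rewrite addrC.
have HS : wH \in S.
  apply: adS; suff -> : ad wG wH = wG by [].
  rewrite /ad {1}/wG -mulrA ZH mulrDr.
  have -> : wH * wG = horner_alg wH R * (wH * wZ).
    by rewrite /wG mulrA horner_alg_comm -mulrA.
  by rewrite addrAC subrr add0r.
have YS : wY \in S.
  apply: adS; have -> : ad wG wY = horner_alg wH R * (wH + 1)
                                   - horner_alg (wH - 1) R * wH.
    rewrite /ad /wG -mulrA -[wZ * wY](subrK (wY * wZ)) weyl_relE.
    by rewrite [wY * (_ * _)]mulrA weyl_Y_horner -mulrA [1 + _]addrC.
  have pS := horner_alg_mem _ SS.
  rewrite addrC -scaleN1r; apply: (lin); apply: (mul) => //.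
  - by apply: pS; rewrite addrC -scaleN1r lin.
  - exact: pS.
  - by rewrite -[wH]scale1r lin.
by move=> /gen_subalgP/(_ S SS) H; apply/asboolP/H => _ [[->|->]|->].
Qed.

Lemma BG_ad_nilp (x : B1) : ad_nilp BG x.
Proof.
have [n x0] := wG_ad_nilp (valP x); exists n; apply: val_inj.
by rewrite val_iter_ad GRing.val0.
Qed.

Lemma sigma_bij : [pchar F] =i pred0 -> bijective sigma.
Proof. by move=> F0; apply: exp_ad_bij F0 BG_ad_nilp. Qed.

Lemma sigmaK : [pchar F] =i pred0 -> cancel sigma sigma_inv.
Proof.
move=> /sigma_bij/bij_inj inj x.
apply: (pinvKV id (A := setT)); last exact: in_setT.
by move=> u v _ _; exact: inj.
Qed.

Lemma sigma_invK : [pchar F] =i pred0 -> cancel sigma_inv sigma.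
Proof.
move=> /sigma_bij[g _ gK] x; apply: pinvK; rewrite inE.
by exists (g x).
Qed.

(* The anti-homomorphism W_1 -> R_2 with Y |-> T, Z |-> n T^-1, and its
   restriction b to B_1^R. *)

Definition weyl_b : weyl F -> R2 F :=
  anti_lift (fun x => if x is gY then rT else rn * rTinv).

Definition b (x : B1) : R2 F := weyl_b (val x).

Fact weyl_b_rel t u : weyl_rel t u ->
  anti_eval (fun x => if x is gY then rT else rn * rTinv : R2 F) t =
  anti_eval (fun x => if x is gY then rT else rn * rTinv) u.
Proof.
have [TV VT Tn _] := R2_relE F.
case=> /=; rewrite scaleN1r mulrN1 scale1r -[rn * _ * rT]mulrA VT mulr1 mulrA.
by rewrite -[rT * rn](subrK (rn * rT)) Tn mulrDl TV -mulrA TV mulr1 addrK.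
Qed.

Lemma b_linear : linear b.
Proof.
by move=> a x y; rewrite /b linearP; apply: anti_lift_linear weyl_b_rel _ _ _.
Qed.

Lemma b1 : b 1 = 1.
Proof. by rewrite /b rmorph1; apply: anti_lift1 weyl_b_rel. Qed.

Lemma bM x y : b (x * y) = b y * b x.
Proof. by rewrite /b rmorphM; apply: anti_liftM weyl_b_rel _ _. Qed.

Lemma weyl_bM x y : weyl_b (x * y) = weyl_b y * weyl_b x.
Proof. exact: anti_liftM weyl_b_rel _ _. Qed.

Lemma weyl_bY : weyl_b wY = rT.
Proof. by rewrite /weyl_b anti_liftE //; apply: weyl_b_rel. Qed.

Lemma weyl_bZ : weyl_b wZ = rn * rTinv.
Proof. by rewrite /weyl_b anti_liftE //; apply: weyl_b_rel. Qed.

Lemma bY : b BY = rT.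
Proof. exact: weyl_bY. Qed.

Lemma weyl_bH : weyl_b wH = rn.
Proof.
have [_ VT _ _] := R2_relE F.
by rewrite weyl_bM weyl_bY weyl_bZ -mulrA VT mulr1.
Qed.

Lemma bH : b BH = rn.
Proof. exact: weyl_bH. Qed.

Lemma bG : b BG = rn * rTinv * horner_alg rn R.
Proof.
rewrite /b /= weyl_bM weyl_bZ; congr (_ * _).
have lin : linear weyl_b by exact: anti_lift_linear weyl_b_rel.
have b0 : weyl_b 0 = 0.
  by have := lin (-1) 0 0; rewrite scaler0 addr0 scaleN1r addNr.
elim/poly_ind: R => [|p c IH]; first by rewrite !rmorph0.
rewrite !rmorphD !rmorphM /= !horner_algX !horner_algC addrC lin weyl_bM.
have -> : weyl_b 1 = 1 by exact: anti_lift1 weyl_b_rel.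
by rewrite weyl_bH IH horner_alg_comm addrC.
Qed.

End B1.

(* Main.v *)
Require Import Defs.
From HB Require Import structures.
From mathcomp Require Import all_boot all_order all_algebra.

(* Since [G H = (H + 1) G], the derivation [ad_G] maps [f(H) G^k] to
   [(Delta f)(H) G^(k+1)], and [ad_G Y = R(H) (H + 1) - R(H - 1) H] is
   [(Delta S)(H)].  Hence [ad_G^j Y = (Delta^j S)(H) G^(j-1)] for [j >= 1], which
   vanishes once [j > deg S = d + 1]; as [sigma^-1 = e^(- ad_G)], applying the
   anti-homomorphism [b] gives the formula. *)

Set Implicit Arguments.
Unset Strict Implicit.
Unset Printing Implicit Defensive.
Import GRing.Theory.
Local Open Scope ring_scope.

Section HornerAlg.
Variables (F : fieldType) (A : algType F).
Implicit Types (g h : A) (p q : {poly F}).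

(** Each factor [h] turns into [h'] as [g] passes it. Applied to [G] with [h' = h + 1] and to
    [rTinv] with [h' = rn - 1]. *)
Lemma horner_alg_intertwine g h h' p :
  g * h = h' * g -> g * horner_alg h p = horner_alg h' p * g.
Proof.
move=> gh; elim/poly_ind: p => [|p c IH]; first by rewrite !rmorph0 mulr0 mul0r.
rewrite !rmorphD !rmorphM /= !horner_algX !horner_algC mulrDr mulrDl mulrA IH.
by rewrite -!mulrA gh mulr_algl mulr_algr.
Qed.

Lemma horner_alg_comp h p q :
  horner_alg h (p \Po q) = horner_alg (horner_alg h q) p.
Proof.
elim/poly_ind: p => [|p c IH]; first by rewrite comp_poly0 !rmorph0.
by rewrite comp_poly_MXaddC !rmorphD !rmorphM /= IH horner_algX !horner_algC.
Qed.

Lemma horner_alg_shift h p : horner_alg h (p \Po ('X + 1)) = horner_alg (h + 1) p.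
Proof. by rewrite horner_alg_comp rmorphD rmorph1 /= horner_algX. Qed.

Lemma iter_ad_horner_alg g h p k j : g * h = (h + 1) * g ->
  iter j (ad g) (horner_alg h p * g ^+ k) =
  horner_alg h (iter j (@Delta F) p) * g ^+ (k + j).
Proof.
move=> gh; elim: j => [|j IH]; first by rewrite addn0.
rewrite !iterS IH /ad mulrA (horner_alg_intertwine _ gh) -!mulrA -exprS -exprSr.
by rewrite -mulrBl /Delta rmorphB /= horner_alg_shift addnS.
Qed.

End HornerAlg.

(** Induction through Delta (p X + c) = Delta p (X + 1) + p, where both summands have size at most
    that of [p]. *)
Lemma size_Delta (F : fieldType) (p : {poly F}) :
  (size (Delta p) <= (size p).-1)%N.
Proof.
elim/poly_ind: p => [|p c IH]; first by rewrite /Delta comp_poly0 subr0 size_poly0.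
have -> : Delta (p * 'X + c%:P) = Delta p * ('X + 1) + p.
  rewrite /Delta comp_poly_MXaddC mulrBl [p * (_ + 1)]mulrDr mulr1.
  by rewrite !opprD addrACA subrr addr0 !addrA subrK.
(* The product is bounded by [(size p).-1 + 1], which is [size p] only for nonzero [p]. *)
rewrite size_MXaddC; have [->|p0] := eqVneq p 0.
  by rewrite /Delta comp_poly0 subr0 mul0r addr0 size_poly0.
rewrite /= (leq_trans (size_polyD _ _)) // geq_max leqnn andbT.
rewrite (leq_trans (size_polyMleq _ _)) // -polyC1 size_XaddC addn2 /=.
by rewrite -(ltn_predK (_ : 0 < size p)%N) ?ltnS // size_poly_gt0.
Qed.

Lemma size_iter_Delta (F : fieldType) (p : {poly F}) n :
  (size (iter n (@Delta F) p) <= size p - n)%N.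
Proof.
elim: n => [|n IH]; first by rewrite subn0.
rewrite iterS subnS (leq_trans (size_Delta _)) //.
by rewrite -!subn1 leq_sub2r.
Qed.

Lemma size_Spoly (F : fieldType) (R : {poly F}) d :
  size R = d.+1 -> size (Spoly R) = d.+2.
Proof.
move=> szR; have sz : size (R \Po ('X - 1)) = d.+1.
  by rewrite size_comp_poly2 // -polyC1 size_XsubC.
by rewrite /Spoly size_mulX ?sz // -size_poly_eq0 sz.
Qed.

Section B1Theory.
Variables (F : fieldType) (R : {poly F}).

Lemma weyl_ZH : wZ * wH = (wH + 1) * wZ :> weyl F.
Proof.
rewrite /wH mulrA -[wZ * wY](subrK (wY * wZ)) weyl_relE.
by rewrite [1 + _]addrC.
Qed.

Lemma val_horner_alg_BH p : val (horner_alg (BH R) p) = horner_alg wH p.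
Proof.
elim/poly_ind: p => [|p c IH]; first by rewrite !rmorph0.
rewrite !rmorphD !rmorphM /= !horner_algX !horner_algC -IH.
by rewrite GRing.valZ rmorph1.
Qed.

Lemma BG_BH : BG R * BH R = (BH R + 1) * BG R.
Proof.
apply: val_inj; rewrite !rmorphM rmorphD rmorph1 /= /wG -mulrA weyl_ZH !mulrA; congr (_ * _).
by rewrite mulrDr mulr1 -horner_alg_comm mulrDl mul1r.
Qed.

(** Here G Y = R(H) Z Y = R(H) (H + 1) = S(H + 1), while Y G = Y R(H) Z = R(H - 1) Y Z = S(H). *)
Lemma ad_BG_BY : ad (BG R) (BY R) = horner_alg (BH R) (Delta (Spoly R)).
Proof.
apply: val_inj; rewrite val_horner_alg_BH /ad rmorphB !rmorphM /= /wG /Delta.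
rewrite rmorphB /= horner_alg_shift /Spoly !rmorphM /= !horner_algX.
rewrite !horner_alg_comp !rmorphB !rmorph1 /= !horner_algX addrK.
rewrite mulrA weyl_Y_horner -!mulrA; congr (_ * _ - _).
by rewrite -[wZ * wY](subrK (wY * wZ)) weyl_relE addrC.
Qed.

Lemma iter_ad_BG_BY j : iter j.+1 (ad (BG R)) (BY R) =
  horner_alg (BH R) (iter j.+1 (@Delta F) (Spoly R)) * BG R ^+ j.
Proof.
have := iter_ad_horner_alg (Delta (Spoly R)) 0 j BG_BH.
by rewrite !iterSr ad_BG_BY mulr1 add0n.
Qed.

(** Makes the abstract inverse computable: write x as sigma (sigma^-1 x) and cancel the two
    exponentials. *)
Lemma sigma_invE : [pchar F] =i pred0 ->
  sigma_inv (R := R) =1 exp_ad (- BG R).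
Proof.
move=> F0 x; rewrite -{2}(sigma_invK F0 x) /sigma exp_adNK //.
exact: BG_ad_nilp.
Qed.

HB.instance Definition _ :=
  GRing.isLinear.Build F (B1 R) (R2 F) _ (@b F R) (@b_linear F R).

(** The reversal of products by [b] is harmless here, since powers of one element commute. *)
Lemma b_horner_alg_BH p : b (horner_alg (BH R) p) = horner_alg rn p.
Proof.
elim/poly_ind: p => [|p c IH]; first by rewrite !rmorph0 linear0.
rewrite !rmorphD !rmorphM /= !horner_algX !horner_algC linearD linearZ /=.
by rewrite bM b1 bH IH horner_alg_comm.
Qed.

Lemma bX (x : B1 R) k : b (x ^+ k) = b x ^+ k.
Proof. by elim: k => [|k IH]; rewrite ?b1 // exprS exprSr bM IH. Qed.

(** The relation T^-1 n = (n - 1) T^-1 carries T^-1 to the right of R(n). *)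
Lemma b_BG : b (BG R) = rn * horner_alg (rn - 1) R * rTinv.
Proof.
have [_ _ _ Vn] := R2_relE F.
rewrite bG -!mulrA (@horner_alg_intertwine _ _ _ _ (rn - 1)) //.
by rewrite mulrBl mul1r -Vn addrC subrK.
Qed.

End B1Theory.

Theorem theorem3p7 (F : fieldType) (charF0 : [pchar F] =i pred0)
    (R : {poly F}) (d : nat) (degR : size R = d.+1) :
  let L : B1 R := sigma (BH R) in
  let b' : B1 R -> R2 F := fun x => b (sigma_inv x) in
  let G' : R2 F := rn * horner_alg (rn - 1) R * rTinv in
  [/\ b' (BG R) = G',
      b' (BY R) = rT + \sum_(1 <= j < d.+2)
        ((-1) ^+ j / j`!%:R : F) *:
          (G' ^+ j.-1 * horner_alg rn (iter j (@Delta F) (Spoly R)))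
    & b' L = rn].
Proof.
move=> L b' G'; split.
(* As [G] commutes with itself, only the term of index 0 survives. *)
- rewrite /b' sigma_invE // (@exp_adE _ _ _ _ 1); last first.
    by rewrite iter_adN /= /ad subrr scaler0.
  by rewrite big_ord1 /= fact0 invr1 scale1r b_BG.
(* S has size [d.+2], so its difference of order [d.+2] has size 0. *)
- rewrite /b' sigma_invE // (@exp_adE _ _ _ _ d.+2); last first.
    rewrite iter_adN iter_ad_BG_BY; have := size_iter_Delta (Spoly R) d.+2.
    rewrite (size_Spoly degR) subnn leqn0 size_poly_eq0 => /eqP ->.
    by rewrite rmorph0 mul0r scaler0.
  (* The term of index 0 is split off: it gives [rT], and only from index 1 on are the iterates of
     the form f(H) G^k. *)
  rewrite linear_sum /= -(big_mkord xpredT (fun j =>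
    b (j`!%:R^-1 *: iter j (ad (- BG R)) (BY R)))) big_nat_recl //.
  rewrite [RHS]/= big_add1 /= fact0 invr1 scale1r bY; congr (_ + _).
  apply: eq_bigr => j _; rewrite linearZ /= -iterS iter_adN linearZ /=.
  (* Being an anti-homomorphism, [b] puts the power of [G'] to the left of the polynomial in
     [rn]. *)
  by rewrite -iterS iter_ad_BG_BY bM bX b_BG b_horner_alg_BH scalerA mulrC.
- by rewrite /b' /L sigmaK // bH.
Qed.
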